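(* Let $k,\ell\ge 2$ be integers. There is exactly one minimal $(k,\ell)$-top-right-crucial permutation; it is of length $k+\ell-3$ and is of the form $$12\cdots(k-2)\,(k+\ell-3)(k+\ell-4)\cdots(k-1),$$ that is, the elements $1,2,\ldots,k-2$ in increasing order followed by the elements $k+\ell-3,k+\ell-4,\ldots,k-1$ in decreasing order.
   Context: $i_m=12\cdots m$ and $d_m=m(m-1)\cdots 1$; a permutation (in one-line notation) contains $i_m$ (resp. $d_m$) if it has an increasing (resp. decreasing) subsequence of length $m$, and avoids it otherwise. The extensions of a permutation $\sigma=\sigma_1\cdots\sigma_n$ of $\{1,\ldots,n\}$ ($n\ge1$) to the right are $e_t(\sigma_1)\cdots e_t(\sigma_n)\,t$, $1\le t\le n+1$, where $e_t(x)=x$ if $x<t$ and $e_t(x)=x+1$ if $x\ge t$. The extensions of $\sigma$ from above are $\sigma_1\cdots\sigma_{t-1}(n+1)\sigma_t\cdots\sigma_n$, $1\le t\le n+1$. A permutation is $(k,\ell)$-top-right-crucial if it avoids $i_k$ and $d_\ell$ but each of its extensions to the right and each of its extensions from above contains $i_k$ or $d_\ell$. Such a permutation is minimal if there is no $(k,\ell)$-top-right-crucial permutation (same $k,\ell$) of smaller length. *)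

(* Defs.v *)
From mathcomp Require Import all_boot.

Set Implicit Arguments.
Unset Strict Implicit.
Unset Printing Implicit Defensive.

(* A permutation of {1, ..., n}, n >= 1, is its one-line word
   [:: sigma_1; ...; sigma_n], with 1-based values; n is [size s]. *)
Definition is_permutation (s : seq nat) : Prop :=
  0 < size s /\ perm_eq s (iota 1 (size s)).

Definition contains_inc (m : nat) (s : seq nat) : Prop :=
  exists u : seq nat, [/\ subseq u s, size u = m & sorted ltn u].

Definition contains_dec (m : nat) (s : seq nat) : Prop :=
  exists u : seq nat, [/\ subseq u s, size u = m & sorted gtn u].

Definition raise (t x : nat) : nat := if x < t then x else x.+1.

Definition extend_right (t : nat) (s : seq nat) : seq nat :=
  rcons (map (raise t) s) t.

(* Positions t are 1-based: the new maximum is inserted just before sigma_t,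
   or at the end when t = n + 1. *)
Definition extend_above (t : nat) (s : seq nat) : seq nat :=
  take t.-1 s ++ (size s).+1 :: drop t.-1 s.

Definition top_right_crucial (k l : nat) (s : seq nat) : Prop :=
  [/\ is_permutation s,
      ~ contains_inc k s,
      ~ contains_dec l s,
      forall t, 1 <= t <= (size s).+1 ->
        contains_inc k (extend_right t s) \/ contains_dec l (extend_right t s)
    & forall t, 1 <= t <= (size s).+1 ->
        contains_inc k (extend_above t s) \/ contains_dec l (extend_above t s)].

Definition minimal_top_right_crucial (k l : nat) (s : seq nat) : Prop :=
  top_right_crucial k l s /\
  ~ exists s' : seq nat, top_right_crucial k l s' /\ size s' < size s.

(* Main.v *)
Require Import Defs.
From mathcomp Require Import all_boot zify.

Set Implicit Arguments.
Unset Strict Implicit.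

(** Write [n] for the length of a crucial permutation [s].  An extension to the
    right by [t] contains [i_k] (through its new entry) exactly when the entries
    of [s] below [t] contain [i_(k-1)], and it contains [d_l] exactly when the
    entries that are at least [t] contain [d_(l-1)].  The first alternative fails
    for [t = 1] and the second for [t = n + 1], so some [x] is such that the
    second holds for [t = x] and the first for [t = x + 1]: the entries [<= x]
    contain [i_(k-1)] and the entries [>= x] contain [d_(l-1)]
    ([crucial_value]).  In the same way, with
    positions in place of values, the extensions from above give an [i] such that
    the first [i + 1] entries contain [i_(k-1)] and the entries from the
    [(i + 1)]-st on contain [d_(l-1)] ([crucial_position]).

    The two stretches of positions share one entry, whence
    [(k - 1) + (l - 1) <= n + 1].  When equality holds every stretch has exactly
    the size of the pattern that it contains, hence is itself monotone, and
    [x = i + 1 = k - 1].  Then [k - 1] is the greatest of an increasing set of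
    values and the least of a decreasing one, every value lies in one of the two,
    and so [k - 1] is the last entry.  As the last [l - 1] entries decrease to
    [k - 1], they are the values [n, ..., k - 1], and the increasing remainder is
    [1, ..., k - 2] ([crucial_shape]). *)

(** * Subsequences and monotone patterns *)

Lemma subseq_cat_split (T : eqType) (w a b : seq T) :
  subseq w (a ++ b) ->
  exists w1 w2, [/\ w = w1 ++ w2, subseq w1 a & subseq w2 b].
Proof.
elim: a w => [|y a IH] w /=; first by exists [::], w.
case: w => [|x w]; first by exists [::], [::]; split; rewrite ?sub0seq.
case: eqP => [->|_] /IH [w1 [w2 [e h1 h2]]].
  by exists (y :: w1), w2; rewrite e /= eqxx.
by exists w1, w2; split=> //; apply: subseq_trans h1 (subseq_cons _ _).
Qed.

Lemma subseq_insert (T : eqType) (w a b : seq T) (x : T) :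
  subseq w (a ++ x :: b) ->
  subseq w (a ++ b) \/
  exists w1 w2, [/\ w = w1 ++ x :: w2, subseq w1 a & subseq w2 b].
Proof.
move=> /subseq_cat_split [w1 [[|y w2] [-> h1]]].
  by move=> _; left; apply: cat_subseq; rewrite ?sub0seq.
rewrite /=; case: eqP => [-> h2|_ h2]; last by left; apply: cat_subseq.
by right; exists w1, w2.
Qed.

(** Both [contains_inc] and [contains_dec] are instances up to conversion, for
    [ltn] and [gtn]; this is what lets the two patterns share their lemmas. *)
Definition contains (r : rel nat) (m : nat) (s : seq nat) : Prop :=
  exists u : seq nat, [/\ subseq u s, size u = m & sorted r u].

Lemma gtn_trans : transitive gtn.
Proof. by move=> y x z /= h1 h2; apply: ltn_trans h1. Qed.

Lemma contains_subseq r m s s' :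
  subseq s s' -> contains r m s -> contains r m s'.
Proof.
by move=> hs [u [h1 h2 h3]]; exists u; split=> //; apply: subseq_trans hs.
Qed.

Lemma contains_size r m s : contains r m s -> m <= size s.
Proof. by move=> [u [/size_subseq h <- _]]. Qed.

Lemma contains_full r m s : contains r m s -> size s <= m -> sorted r s.
Proof.
move=> [u [h1 h2 h3]] hs; have := size_subseq_leqif h1.
by move=> [h4 h5]; move: h5; rewrite eqn_leq h4 h2 hs => /esym /eqP <-.
Qed.

Lemma sorted_cat_consE (r : rel nat) (s1 s2 : seq nat) (x : nat) :
  transitive r ->
  sorted r (s1 ++ x :: s2) ->
  [/\ all (r^~ x) s1, all (r x) s2, sorted r s1 & sorted r s2].
Proof.
move=> rt; rewrite !sorted_pairwise // pairwise_cat allrel_consr /=.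
by case/and3P=> /andP [-> _] -> /andP [-> ->].
Qed.

Lemma sorted_rconsE (r : rel nat) (s : seq nat) (x : nat) :
  transitive r -> sorted r (rcons s x) = all (r^~ x) s && sorted r s.
Proof. by move=> rt; rewrite !sorted_pairwise // pairwise_rcons. Qed.

(** * Patterns in the extensions *)

(** A new occurrence of the pattern ends with the appended entry, so it comes
    from a shorter occurrence among the entries that may precede it. *)
Lemma contains_extend_right (r : rel nat) m t s :
  transitive r -> {mono raise t : x y / r x y} ->
  contains r m.+1 (extend_right t s) <->
  contains r m.+1 s \/ contains r m [seq x <- s | r (raise t x) t].
Proof.
move=> rt rm; rewrite /extend_right; split.
  rewrite -cats1 => -[w [/subseq_insert []]].
    rewrite cats0 => /subseqP [b _ ->]; rewrite -map_mask size_map => sz.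
    rewrite (mono_sorted rm) => so; left; exists (mask b s).
    by rewrite mask_subseq.
  move=> [w1 [w2 [-> /subseqP [b _ ->]]]]; rewrite -map_mask subseq0 => /eqP ->.
  rewrite size_cat size_map addn1 => -[sz].
  move=> /sorted_cat_consE [] // ha _; rewrite (mono_sorted rm) => so _.
  right; exists (mask b s); rewrite subseq_filter mask_subseq andbT.
  by move: ha; rewrite all_map.
case=> -[u [hu <- so]].
  exists (map (raise t) u); rewrite size_map (mono_sorted rm); split=> //.
  exact: subseq_trans (map_subseq _ hu) (subseq_rcons _ _).
move: hu; rewrite subseq_filter => /andP [ha hu].
exists (rcons (map (raise t) u) t).
rewrite size_rcons size_map sorted_rconsE // (mono_sorted rm) so all_map ha.
by rewrite -!cats1 subseq_cat2r map_subseq.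
Qed.

Lemma contains_inc_extend_right m t s :
  contains_inc m.+1 (extend_right t s) <->
  contains_inc m.+1 s \/ contains_inc m [seq x <- s | x < t].
Proof.
have -> : [seq x <- s | x < t] = [seq x <- s | ltn (raise t x) t].
  by apply: eq_filter => x; rewrite /raise /=; case: ifP; lia.
apply: contains_extend_right; first exact: ltn_trans.
by move=> x y; rewrite /raise /=; do 2 case: ifP; lia.
Qed.

Lemma contains_dec_extend_right m t s :
  contains_dec m.+1 (extend_right t s) <->
  contains_dec m.+1 s \/ contains_dec m [seq x <- s | t <= x].
Proof.
have -> : [seq x <- s | t <= x] = [seq x <- s | gtn (raise t x) t].
  by apply: eq_filter => x; rewrite /raise /=; case: ifP; lia.
apply: contains_extend_right; first exact: gtn_trans.
by move=> x y; rewrite /raise /=; do 2 case: ifP; lia.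
Qed.

Lemma subseq_insert_sub (T : eqType) (i : nat) (x : T) (s : seq T) :
  subseq s (take i s ++ x :: drop i s).
Proof. by rewrite -{1}(cat_take_drop i s) subseq_cat2l subseq_cons. Qed.

(** A new occurrence uses the inserted maximum, which can only be the last entry
    of an increasing pattern. *)
Lemma contains_inc_extend_above m i s :
  all (leq^~ (size s)) s ->
  contains_inc m.+1 (extend_above i.+1 s) <->
  contains_inc m.+1 s \/ contains_inc m (take i s).
Proof.
move=> le_s; rewrite /extend_above /=; split.
  move=> [w [/subseq_insert []]]; first by rewrite cat_take_drop; left; exists w.
  move=> [w1 [w2 [-> h1 h2]]] + /(sorted_cat_consE ltn_trans) [_].
  case: w2 h2 => [|y w2] h2; rewrite size_cat /=.
    by move=> sz _ so _; right; exists w1; split=> //; lia.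
  have /(allP le_s) : y \in s by exact: mem_drop (mem_subseq h2 (mem_head _ _)).
  by move=> h _ /andP []; lia.
case; first exact/contains_subseq/subseq_insert_sub.
move=> [u [hu <- so]]; exists (rcons u (size s).+1).
rewrite size_rcons sorted_rconsE ?so; last exact: ltn_trans.
split=> //.
  by rewrite -cats1; apply: cat_subseq => //=; rewrite eqxx sub0seq.
rewrite andbT; apply/allP => x /(mem_subseq hu) /mem_take /(allP le_s).
by rewrite /=; lia.
Qed.

(** Dually, the inserted maximum can only be the first entry of a decreasing
    pattern. *)
Lemma contains_dec_extend_above m i s :
  all (leq^~ (size s)) s ->
  contains_dec m.+1 (extend_above i.+1 s) <->
  contains_dec m.+1 s \/ contains_dec m (drop i s).
Proof.
move=> le_s; rewrite /extend_above /=; split.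
  move=> [w [/subseq_insert []]]; first by rewrite cat_take_drop; left; exists w.
  move=> [w1 [w2 [-> h1 h2]]] + /(sorted_cat_consE gtn_trans) [].
  case: w1 h1 => [|y w1] h1; rewrite size_cat /=.
    by move=> sz _ _ _ so; right; exists w2; split=> //; lia.
  have /(allP le_s) : y \in s by exact: mem_take (mem_subseq h1 (mem_head _ _)).
  by move=> h _ /andP []; lia.
case; first exact/contains_subseq/subseq_insert_sub.
move=> [u [hu <- so]]; exists ((size s).+1 :: u).
split=> //.
  by apply: (@cat_subseq _ [::]); rewrite ?sub0seq //= eqxx.
rewrite /= path_sortedE ?so; last exact: gtn_trans.
rewrite andbT; apply/allP => x /(mem_subseq hu) /mem_drop /(allP le_s).
by rewrite /=; lia.
Qed.

(** * The crossing argument *)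

Lemma crossing (P Q : nat -> Prop) (n : nat) :
  (forall i, i <= n -> P i \/ Q i) -> ~ P 0 -> ~ Q n ->
  exists i, [/\ i < n, P i.+1 & Q i].
Proof.
move=> PQ P0 Qn; have {Qn} Pn : P n by case: (PQ n).
suff H j : j <= n -> P j -> exists i, [/\ i < n, P i.+1 & Q i] by exact: H Pn.
elim: j => // j IH hj Pj; case: (PQ j) => [|Pj'|Qj]; first exact: ltnW.
  exact: IH (ltnW hj) Pj'.
by exists j.
Qed.

(** * Permutation words *)

Lemma perm_mem_iota s x : is_permutation s -> (x \in s) = (0 < x <= size s).
Proof. by case=> _ /perm_mem ->; rewrite mem_iota add1n ltnS. Qed.

Lemma perm_uniq_iota s : is_permutation s -> uniq s.
Proof. by case=> _ /perm_uniq ->; apply: iota_uniq. Qed.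

Lemma perm_all_leq s : is_permutation s -> all (leq^~ (size s)) s.
Proof. by move=> ps; apply/allP => x; rewrite perm_mem_iota // => /andP []. Qed.

Lemma size_filter_leq s x :
  is_permutation s -> size [seq y <- s | y <= x] <= x.
Proof.
move=> ps; rewrite -[leqRHS](size_iota 1); apply: uniq_leq_size.
  by apply: filter_uniq; apply: perm_uniq_iota.
by move=> y; rewrite mem_filter perm_mem_iota // mem_iota; lia.
Qed.

Lemma size_filter_geq s x :
  is_permutation s -> size [seq y <- s | x <= y] <= (size s).+1 - x.
Proof.
move=> ps; rewrite -[leqRHS](size_iota x); apply: uniq_leq_size.
  by apply: filter_uniq; apply: perm_uniq_iota.
by move=> y; rewrite mem_filter perm_mem_iota // mem_iota; lia.
Qed.

(** The last entry lies on one side of [x], say below; being last among the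
    increasing entries [<= x], it is at least [x]. *)
Lemma last_increasing_below_decreasing_above s x :
  x \in s -> sorted ltn [seq y <- s | y <= x] ->
  sorted gtn [seq y <- s | x <= y] -> last 0 s = x.
Proof.
case/lastP: s => // s z; rewrite last_rcons mem_rcons inE.
rewrite !filter_rcons; case: ltngtP => //= zx xs inc dec.
- move: inc; rewrite sorted_rconsE; last exact: ltn_trans.
  by case/andP=> /allP /(_ x); rewrite mem_filter leqnn xs => /(_ isT) /=; lia.
- move: dec; rewrite sorted_rconsE; last exact: gtn_trans.
  by case/andP=> /allP /(_ x); rewrite mem_filter leqnn xs => /(_ isT) /=; lia.
Qed.

(** The last [q + 1] entries decrease to [p + 1], so they are among the [q + 1]
    values from [p + 1] to [p + q + 1] and exhaust them. *)
Lemma increasing_then_decreasing_to s p q :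
  is_permutation s -> size s = p + q.+1 ->
  sorted ltn (take p s) -> sorted gtn (drop p s) -> last 0 s = p.+1 ->
  s = iota 1 p ++ rev (iota p.+1 q.+1).
Proof.
move=> ps sz inc dec lst.
have perm_drop : perm_eq (drop p s) (iota p.+1 q.+1).
  have uq : uniq (drop p s) by apply: drop_uniq; apply: perm_uniq_iota.
  apply: uniq_perm; rewrite ?iota_uniq //.
  have sub : {subset drop p s <= iota p.+1 q.+1}.
    move=> y yd; have := mem_drop yd; rewrite perm_mem_iota // mem_iota.
    suff : p < y by lia.
    move: lst yd dec; rewrite -{1}(cat_take_drop p s) last_cat.
    case/lastP: (drop p s) => // d z; rewrite last_rcons => ->.
    rewrite mem_rcons inE sorted_rconsE; last exact: gtn_trans.
    by case: eqP => [-> //|_] /= yd /andP [/allP /(_ y yd) /ltnW].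
  have le_sz : size (iota p.+1 q.+1) <= size (drop p s).
    by rewrite size_iota size_drop sz; lia.
  exact: (uniq_min_size uq sub le_sz).2.
have perm_take : perm_eq (take p s) (iota 1 p).
  rewrite -(perm_cat2r (drop p s)) cat_take_drop.
  have [_ ps'] := ps; apply: perm_trans ps' _.
  by rewrite sz iotaD perm_cat2l add1n perm_sym.
rewrite -{1}(cat_take_drop p s); congr (_ ++ _).
  apply: irr_sorted_eq inc (iota_ltn_sorted _ _) (perm_mem perm_take).
    exact: ltn_trans.
  exact: ltnn.
apply: irr_sorted_eq dec _ _.
- exact: gtn_trans.
- exact: ltnn.
- by rewrite rev_sorted; apply: iota_ltn_sorted.
- by move=> y; rewrite mem_rev (perm_mem perm_drop).
Qed.

(** * Crucial permutations *)

Lemma crucial_value p q s : top_right_crucial p.+2 q.+2 s ->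
  exists x, [/\ 0 < x <= size s, contains_inc p.+1 [seq y <- s | y <= x]
              & contains_dec q.+1 [seq y <- s | x <= y]].
Proof.
case=> ps ninc ndec right_s _.
have [|||i [hi Pi Qi]] := @crossing
  (fun i => contains_inc p.+1 [seq y <- s | y < i.+1])
  (fun i => contains_dec q.+1 [seq y <- s | i.+1 <= y]) (size s).
- move=> i hi; have [/contains_inc_extend_right []|] := right_s i.+1 hi => //.
    by left.
  by move=> /contains_dec_extend_right [] //; right.
- move=> /contains_size; have := size_filter_leq 0 ps.
  by rewrite leqn0 => /eqP ->.
- move=> /contains_size; have := size_filter_geq (size s).+1 ps.
  by rewrite subnn leqn0 => /eqP ->.
by exists i.+1.
Qed.

Lemma crucial_position p q s : top_right_crucial p.+2 q.+2 s ->
  exists i, [/\ i < size s, contains_inc p.+1 (take i.+1 s)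
              & contains_dec q.+1 (drop i s)].
Proof.
case=> ps ninc ndec _ above_s; have le_s := perm_all_leq ps.
apply: (@crossing (fun i => contains_inc p.+1 (take i s))
                  (fun i => contains_dec q.+1 (drop i s))).
- move=> i hi.
  have [/(contains_inc_extend_above _ _ le_s) []|] := above_s i.+1 hi => //.
    by left.
  by move=> /(contains_dec_extend_above _ _ le_s) [] //; right.
- by rewrite take0 => /contains_size.
- by rewrite drop_size => /contains_size.
Qed.

Lemma crucial_size p q s : top_right_crucial p.+2 q.+2 s -> p + q < size s.
Proof.
move=> /crucial_position [i [hi /contains_size + /contains_size]].
by rewrite size_takel // size_drop; lia.
Qed.

(** At the least possible length both crossings are tight: each stretch of
    positions or of values is no longer than the pattern that it contains. *)
Lemma crucial_shape p q s : top_right_crucial p.+2 q.+2 s ->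
  size s = p + q.+1 -> s = iota 1 p ++ rev (iota p.+1 q.+1).
Proof.
move=> crucial_s sz; have [ps _ _ _ _] := crucial_s.
have [x [hx inc_x dec_x]] := crucial_value crucial_s.
have [i [hi inc_i dec_i]] := crucial_position crucial_s.
have le_x := size_filter_leq x ps; have ge_x := size_filter_geq x ps.
have xp : x = p.+1.
  by move: (contains_size inc_x) (contains_size dec_x); lia.
have ip : i = p.
  move: (contains_size inc_i) (contains_size dec_i).
  by rewrite size_takel // size_drop; lia.
subst x i; apply: increasing_then_decreasing_to => //.
- rewrite -(take_takel s (leqnSn p)); apply: take_sorted.
  by apply: contains_full inc_i _; rewrite size_takel.
- by apply: contains_full dec_i _; rewrite size_drop; lia.
- apply: last_increasing_below_decreasing_above.
  + by rewrite perm_mem_iota.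
  + exact: contains_full inc_x le_x.
  + by apply: contains_full dec_x _; lia.
Qed.

(** * The minimal crucial permutation *)

(** An increasing subsequence has at most [p] entries in the increasing part and
    one in the decreasing part; a decreasing one cannot have entries in both
    parts, as the first part lies entirely below the second.  The extensions by
    [t <= p + 1], in either direction, add an entry to the [q + 1] decreasing
    ones; for larger [t] they complete the [p] increasing ones together with one
    entry of the decreasing part, the last one on the right and the first one
    from above. *)
Lemma shape_crucial p q :
  top_right_crucial p.+2 q.+2 (iota 1 p ++ rev (iota p.+1 q.+1)).
Proof.
set D := rev _; set s := iota 1 p ++ D.
have szD : size D = q.+1 by rewrite size_rev size_iota.
have sz : size s = p + q.+1 by rewrite size_cat size_iota szD.
have decD : sorted gtn D by rewrite rev_sorted; apply: iota_ltn_sorted.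
have ps : is_permutation s.
  split; first by rewrite sz addnS.
  by rewrite sz iotaD perm_cat2l add1n perm_rev.
have le_s := perm_all_leq ps.
have short (u : seq nat) : sorted ltn u -> sorted gtn u -> size u <= 1.
  by case: u => [|x [|y u]] //= /andP [h1 _] /andP [h2 _]; lia.
split=> //.
- move=> [u [/subseq_cat_split [u1 [u2 [-> h1 h2]]] + inc_u]].
  have [_ inc2] := cat_sorted2 inc_u.
  have dec2 := subseq_sorted gtn_trans h2 decD.
  have := leq_add (size_subseq h1) (short _ inc2 dec2).
  by rewrite size_iota -size_cat => + eq_sz; rewrite eq_sz addn1 ltnn.
- move=> [u [/subseq_cat_split [u1 [[|y u2] [-> h1 h2]]] + dec_u]].
    have [dec1 _] := cat_sorted2 dec_u.
    have inc1 := subseq_sorted ltn_trans h1 (iota_ltn_sorted _ _).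
    have := short _ inc1 dec1.
    by rewrite cats0 => + eq_sz; rewrite eq_sz.
  case: u1 h1 dec_u => [|x u1] h1 dec_u.
    by have := size_subseq h2; rewrite szD /=; lia.
  have [/andP [yx _] _ _ _] := sorted_cat_consE gtn_trans dec_u.
  have := mem_subseq h1 (mem_head _ _); have := mem_subseq h2 (mem_head _ _).
  by rewrite mem_rev !mem_iota; move: yx => /=; lia.
- move=> t ht; case: (leqP t p.+1) => htp; [right|left].
    apply/contains_dec_extend_right; right; exists D; split=> //.
    rewrite subseq_filter suffix_subseq andbT; apply/allP => y.
    by rewrite mem_rev mem_iota; lia.
  apply/contains_inc_extend_right; right; exists (iota 1 p ++ [:: p.+1]).
  rewrite size_cat size_iota addn1 -[[:: _]]/(iota p.+1 1) -iotaD iota_ltn_sorted.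
  split=> //; rewrite subseq_filter; apply/andP; split.
    by apply/allP => y; rewrite mem_iota; lia.
  by rewrite iotaD subseq_cat2l sub1seq mem_rev mem_iota; lia.
- case=> // i hi; case: (leqP i p) => hip; [right|left].
    apply/contains_dec_extend_above => //; right; exists D; split=> //.
    rewrite drop_cat size_iota; case: ltnP => _; first exact: suffix_subseq.
    by rewrite (_ : i - p = 0) ?drop0 //; lia.
  apply/contains_inc_extend_above => //; right.
  exists (rcons (iota 1 p) (p + q.+1)).
  rewrite size_rcons size_iota sorted_rconsE; last exact: ltn_trans.
  split=> //.
    have -> : rcons (iota 1 p) (p + q.+1) = take p.+1 s.
      rewrite /s /D -[q.+1 in RHS]addn1 iotaD rev_cat take_cat size_iota.
      by rewrite ltnNge leqnSn /= subSnn /= take0 addSnnS cats1.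
    by rewrite -(take_takel s hip) take_subseq.
  by rewrite iota_ltn_sorted andbT; apply/allP => y; rewrite mem_iota /=; lia.
Qed.

Unset Implicit Arguments.

Theorem theorem10 (k l : nat) (hk : 2 <= k) (hl : 2 <= l) :
  exists s : seq nat,
    [/\ unique (minimal_top_right_crucial k l) s,
        size s = k + l - 3
      & s = iota 1 (k - 2) ++ rev (iota (k - 1) (l - 1))].
Proof.
(* [p] and [q] avoid truncated subtraction: [k = p + 2] and [l = q + 2]. *)
case: k l hk hl => [|[|p]] [|[|q]] // _ _.
have -> : p.+2 + q.+2 - 3 = p + q.+1 by lia.
rewrite !subSS !subn0; set s0 := _ ++ _.
have sz0 : size s0 = p + q.+1 by rewrite size_cat size_rev !size_iota.
exists s0; split=> //.
split=> [|s [crucial_s min_s]].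
  split; first exact: shape_crucial.
  by move=> [s [/crucial_size lb]]; rewrite sz0 addnS ltnS leqNgt lb.
apply/esym/crucial_shape => //.
apply/eqP; rewrite eqn_leq addnS (crucial_size crucial_s) andbT leqNgt.
apply/negP => lt_s; case: min_s; exists s0.
by split; [exact: shape_crucial | rewrite sz0 addnS].
Qed.
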